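(* Every variety of generalized Sugihara monoids has surjective epimorphisms (i.e., has the ES property).
   Context: A (commutative) residuated lattice (RL) is an algebra $\langle A;\cdot,\to,\wedge,\vee,e\rangle$ such that $\langle A;\cdot,e\rangle$ is a commutative monoid, $\langle A;\wedge,\vee\rangle$ is a lattice, and $x\cdot y\leqslant z \iff y\leqslant x\to z$. It is idempotent if $a\cdot a=a$ for all $a$, and semilinear if it is isomorphic to a subdirect product of totally ordered RLs. Write $x^*:=x\to e$. The variety of generalized Sugihara monoids consists of the semilinear idempotent RLs satisfying the equation $(x\vee e)^{**}=x\vee e$. For a class $\mathcal K$ of similar algebras, a homomorphism $f\colon\mathbf A\to\mathbf B$ with $\mathbf A,\mathbf B\in\mathcal K$ is a $\mathcal K$-epimorphism if for all homomorphisms $g,h\colon\mathbf B\to\mathbf C$ with $\mathbf C\in\mathcal K$, $g\circ f=h\circ f$ implies $g=h$; $\mathcal K$ has the ES property if every $\mathcal K$-epimorphism is surjective. *)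

(* Defs.v *)
From mathcomp Require Import ssreflect ssrfun ssrbool.

Set Implicit Arguments.
Unset Strict Implicit.
Unset Printing Implicit Defensive.

(* Algebras in the similarity type of residuated lattices; no law is imposed
   here, so that varieties can be classes of algebras defined by equations. *)
Record algebra : Type := Algebra {
  carrier :> Type;
  mul : carrier -> carrier -> carrier;
  res : carrier -> carrier -> carrier;
  meet : carrier -> carrier -> carrier;
  join : carrier -> carrier -> carrier;
  unit_e : carrier }.

Arguments mul {A} x y : rename.
Arguments res {A} x y : rename.
Arguments meet {A} x y : rename.
Arguments join {A} x y : rename.
Arguments unit_e {A} : rename.

Definition le (A : algebra) (x y : A) : Prop := meet x y = x.

Definition star (A : algebra) (x : A) : A := res x unit_e.

Definition is_comm_monoid (T : Type) (op : T -> T -> T) (e : T) : Prop :=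
  [/\ associative op, commutative op & left_id e op].

Definition is_lattice (T : Type) (m j : T -> T -> T) : Prop :=
  [/\ associative m /\ associative j,
      commutative m /\ commutative j,
      (forall x y, m x (j x y) = x) & (forall x y, j x (m x y) = x)].

Definition is_RL (A : algebra) : Prop :=
  [/\ is_comm_monoid (@mul A) unit_e,
      is_lattice (@meet A) (@join A)
    & forall x y z : A, le (mul x y) z <-> le y (res x z)].

Definition totally_ordered (A : algebra) : Prop :=
  forall x y : A, le x y \/ le y x.

Definition idempotent_alg (A : algebra) : Prop := forall x : A, mul x x = x.

Definition is_hom (A B : algebra) (f : A -> B) : Prop :=
  [/\ {morph f : x y / mul x y >-> mul x y},
      {morph f : x y / res x y >-> res x y},
      {morph f : x y / meet x y >-> meet x y},
      {morph f : x y / join x y >-> join x y}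
    & f unit_e = unit_e].

Definition surjective (S T : Type) (f : S -> T) : Prop :=
  forall y, exists x, f x = y.

Definition product_alg (I : Type) (B : I -> algebra) : algebra :=
  @Algebra (forall i, B i)
    (fun x y i => mul (x i) (y i))
    (fun x y i => res (x i) (y i))
    (fun x y i => meet (x i) (y i))
    (fun x y i => join (x i) (y i))
    (fun i => unit_e).

(* [A] is isomorphic, via [j], to a subdirect product of the family [B]:
   [j] is an isomorphism onto a subalgebra of the product that projects onto
   every factor. *)
Definition subdirect_embedding (A : algebra) (I : Type) (B : I -> algebra)
    (j : A -> product_alg B) : Prop :=
  [/\ is_hom j, injective j & forall i, surjective (fun x => j x i)].

Definition semilinear (A : algebra) : Prop :=
  exists (I : Type) (B : I -> algebra) (j : A -> product_alg B),
    (forall i, is_RL (B i) /\ totally_ordered (B i)) /\ subdirect_embedding j.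

Definition generalized_Sugihara_monoid (A : algebra) : Prop :=
  [/\ is_RL A, semilinear A, idempotent_alg A
    & forall x : A, star (star (join x unit_e)) = join x unit_e].

Inductive term : Type :=
  | Var of nat
  | Mul of term & term
  | Res of term & term
  | Meet of term & term
  | Join of term & term
  | Unit.

Fixpoint eval (A : algebra) (v : nat -> A) (t : term) : A :=
  match t with
  | Var n => v n
  | Mul s u => mul (eval v s) (eval v u)
  | Res s u => res (eval v s) (eval v u)
  | Meet s u => meet (eval v s) (eval v u)
  | Join s u => join (eval v s) (eval v u)
  | Unit => unit_e
  end.

Definition satisfies (A : algebra) (s t : term) : Prop :=
  forall v : nat -> A, eval v s = eval v t.

Definition is_variety (K : algebra -> Prop) : Prop :=
  exists E : term -> term -> Prop,
    forall A, K A <-> (forall s t, E s t -> satisfies A s t).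

Definition is_epimorphism (K : algebra -> Prop) (A B : algebra) (f : A -> B)
    : Prop :=
  [/\ K A, K B, is_hom f
    & forall (C : algebra) (g h : B -> C),
        K C -> is_hom g -> is_hom h -> g \o f =1 h \o f -> g =1 h].

Definition ES_property (K : algebra -> Prop) : Prop :=
  forall (A B : algebra) (f : A -> B), is_epimorphism K f -> surjective f.

(* Main.v *)
From mathcomp Require Import ssreflect ssrfun ssrbool boolp classical_sets.
Require Import Defs.

Set Implicit Arguments.
Unset Strict Implicit.
Unset Printing Implicit Defensive.

(** Let [A0] be the image of an epimorphism into [B].  Deductive filters of an
    idempotent residuated lattice are its lattice filters containing [e], and
    prime filters have totally ordered quotients.

    (1) [A0] maps onto every totally ordered quotient [P] of [B].  If [b < e]
    in [P] is missed by [A0], factor out all elements of [A0] above [b]; no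
    element of the image of [A0] is then left strictly between [b] and [e].
    In the resulting chain [C], collapsing to [e] the interval
    [{x | b <= x <= b^*}] (or [{x | x^* <= b^* and x^** <= b^*}] when
    [b^* <> e]) and fixing everything else is an endomorphism that fixes the
    image of [A0] but moves [b].

    (2) For two prime filters [p], [q] and [b] in [B], some [m] in [A0] is
    congruent to [b] modulo both.  Let [r] be the filter generated by [p] and
    [A0 /\ q].  Besides the projection there is a second map [B -> B/r], which
    sends [x] to the class of any element of [A0] congruent to [x] modulo [q].
    They agree on [A0], hence on [b], and a Mal'cev term turns this into the
    required [m].

    (3) A Baker-Pixley argument, with the prime filter theorem in place of
    compactness, glues these [m] into [b] itself. *)

(** * Subuniverses, homomorphisms and equational classes *)

Definition subuniverse (A : algebra) (H : A -> Prop) : Prop :=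
  [/\ forall x y, H x -> H y -> H (mul x y),
      forall x y, H x -> H y -> H (res x y),
      forall x y, H x -> H y -> H (meet x y),
      forall x y, H x -> H y -> H (join x y)
    & H unit_e].

Lemma hom_comp (A B C : algebra) (f : A -> B) (g : B -> C) :
  is_hom f -> is_hom g -> is_hom (g \o f).
Proof.
case=> f1 f2 f3 f4 f5 [g1 g2 g3 g4 g5].
by split=> [x y|x y|x y|x y|] /=; rewrite ?(f1, f2, f3, f4, f5) ?(g1, g2, g3, g4, g5).
Qed.

Lemma hom_id (A : algebra) : is_hom (@id A).
Proof. by split. Qed.

Lemma subuniverse_image (A B : algebra) (f : A -> B) (H : A -> Prop) :
  is_hom f -> subuniverse H -> subuniverse (fun y => exists2 x, H x & f x = y).
Proof.
move=> [f1 f2 f3 f4 f5] [H1 H2 H3 H4 H5]; split.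
- by move=> _ _ [x hx <-] [y hy <-]; exists (mul x y); [exact: H1 | exact: f1].
- by move=> _ _ [x hx <-] [y hy <-]; exists (res x y); [exact: H2 | exact: f2].
- by move=> _ _ [x hx <-] [y hy <-]; exists (meet x y); [exact: H3 | exact: f3].
- by move=> _ _ [x hx <-] [y hy <-]; exists (join x y); [exact: H4 | exact: f4].
- by exists unit_e.
Qed.

Lemma eval_hom (A B : algebra) (f : A -> B) (v : nat -> A) (t : term) :
  is_hom f -> eval (f \o v) t = f (eval v t).
Proof.
case=> f1 f2 f3 f4 f5.
by elim: t => //= s -> u ->; rewrite ?(f1, f2, f3, f4).
Qed.

(** Valuations in [C] lift along a chosen section of [f], so every identity of [B] passes to [C]. *)
Lemma variety_quotient (K : algebra -> Prop) (B C : algebra) (f : B -> C) :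
  is_variety K -> K B -> is_hom f -> surjective f -> K C.
Proof.
move=> [E hE] /hE hB hf /choice [g hg]; apply/hE => s t hst v.
have -> : v = f \o (g \o v) by apply: funext => n /=; rewrite hg.
by rewrite !(eval_hom (g \o v) _ hf); congr f; exact: hB.
Qed.

(** Used to check distributivity and prelinearity on chains only, coordinate by coordinate. *)
Lemma semilinear_satisfies (A : algebra) (s t : term) : semilinear A ->
  (forall C, is_RL C -> totally_ordered C -> satisfies C s t) -> satisfies A s t.
Proof.
move=> [I [B [j [hB [hj injj _]]]]] hst v; apply: injj; apply: functional_extensionality_dep => i.
have hji : is_hom (fun x => j x i).
  case: hj => j1 j2 j3 j4 j5.
  by split=> [x y|x y|x y|x y|]; rewrite ?(j1, j2, j3, j4, j5).
have [hR hT] := hB i.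
by rewrite -!(eval_hom v _ hji) hst.
Qed.

(** * Residuated lattices *)

Section RL.
Variable A : algebra.
Hypothesis hA : is_RL A.
Implicit Types x y z u v w : A.
Local Notation e := (@unit_e A).

Lemma mulA x y z : mul x (mul y z) = mul (mul x y) z.
Proof. by case: hA => -[]. Qed.
Lemma mulC x y : mul x y = mul y x.
Proof. by case: hA => -[]. Qed.
Lemma mul1 x : mul e x = x.
Proof. by case: hA => -[]. Qed.
Lemma mulr1 x : mul x e = x.
Proof. by rewrite mulC mul1. Qed.
Lemma meetA x y z : meet x (meet y z) = meet (meet x y) z.
Proof. by case: hA => _ [] []. Qed.
Lemma meetC x y : meet x y = meet y x.
Proof. by case: hA => _ [] _ []. Qed.
Lemma joinC x y : join x y = join y x.
Proof. by case: hA => _ [] _ []. Qed.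
Lemma joinA x y z : join x (join y z) = join (join x y) z.
Proof. by case: hA => _ [] []. Qed.
Lemma meetK x y : meet x (join x y) = x.
Proof. by case: hA => _ []. Qed.
Lemma joinK x y : join x (meet x y) = x.
Proof. by case: hA => _ []. Qed.
Lemma residuation x y z : le (mul x y) z <-> le y (res x z).
Proof. by case: hA. Qed.

Lemma res_intro x y z : le (mul x y) z -> le y (res x z).
Proof. by rewrite residuation. Qed.

Lemma le_refl x : le x x.
Proof. by rewrite /le -{2}(joinK x x) meetK. Qed.
Lemma le_anti x y : le x y -> le y x -> x = y.
Proof. by rewrite /le => h1 h2; rewrite -h1 meetC. Qed.
Lemma le_trans y x z : le x y -> le y z -> le x z.
Proof. by rewrite /le => h1 h2; rewrite -h1 -meetA h2. Qed.
Lemma le_joinE x y : le x y <-> join x y = y.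
Proof.
split=> [<-|<-]; last exact: meetK.
by rewrite joinC meetC joinK.
Qed.
Lemma meet_l x y : le (meet x y) x.
Proof. by rewrite /le meetC meetA le_refl. Qed.
Lemma meet_r x y : le (meet x y) y.
Proof. by rewrite meetC; exact: meet_l. Qed.
Lemma meet_glb z x y : le z x -> le z y -> le z (meet x y).
Proof. by rewrite /le => h1 h2; rewrite meetA h1. Qed.
Lemma join_l x y : le x (join x y).
Proof. exact: meetK. Qed.
Lemma join_r x y : le y (join x y).
Proof. by rewrite joinC; exact: join_l. Qed.
Lemma join_lub z x y : le x z -> le y z -> le (join x y) z.
Proof. by move=> /le_joinE h1 /le_joinE h2; apply/le_joinE; rewrite -joinA h2. Qed.

Lemma le_mul_res x y : le (mul x (res x y)) y.
Proof. by apply/residuation; exact: le_refl. Qed.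
Lemma mul_mono x y u v : le x y -> le u v -> le (mul x u) (mul y v).
Proof.
have h (a b c : A) : le b c -> le (mul a b) (mul a c).
  by move=> hbc; apply/residuation; apply: (le_trans hbc); apply/residuation; exact: le_refl.
move=> hxy huv; apply: (le_trans (h x _ _ huv)).
by rewrite (mulC x) (mulC y); exact: h.
Qed.
Lemma res_mono x y u v : le y x -> le u v -> le (res x u) (res y v).
Proof.
move=> hyx huv; apply: res_intro.
apply: (le_trans (mul_mono hyx (le_refl _))).
exact: le_trans (le_mul_res _ _) huv.
Qed.
Lemma res_ge_e x y : le e (res x y) <-> le x y.
Proof. by rewrite -residuation mulr1. Qed.
Lemma res_e x : res e x = x.
Proof.
apply: le_anti; first by have := le_mul_res e x; rewrite mul1.
by apply: res_intro; rewrite mul1; exact: le_refl.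
Qed.
Lemma res_trans x y z : le (mul (res x y) (res y z)) (res x z).
Proof.
apply: res_intro; rewrite mulA; apply: le_trans (le_mul_res y z).
by apply: mul_mono (le_refl _); exact: le_mul_res.
Qed.

Lemma star_e : star e = e.
Proof. exact: res_e. Qed.
Lemma star_anti x y : le x y -> le (star y) (star x).
Proof. by move=> h; apply: res_mono h (le_refl _). Qed.
Lemma le_star x y : le x (star y) <-> le y (star x).
Proof. by rewrite -!residuation mulC. Qed.
Lemma le_starstar x : le x (star (star x)).
Proof. by apply/le_star; exact: le_refl. Qed.
Lemma star3 x : star (star (star x)) = star x.
Proof. by apply: le_anti (le_starstar _); apply: star_anti; exact: le_starstar. Qed.
Lemma star_neg x : le x e -> le e (star x).
Proof. by rewrite -{1}star_e => /le_star. Qed.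
Lemma star_pos x : le e x -> le (star x) e.
Proof. by move=> h; rewrite -star_e; exact: star_anti. Qed.

(** A Mal'cev term. Since [res x x] may exceed [e], it is cut at [e], so that the first antecedent
    is exactly [e] when [x = y]. *)
Definition maltsev x y z :=
  meet (res (meet (res x y) e) z) (res (meet (res z y) e) x).

Lemma le_res_meet_res x y : le x (res (meet (res x y) e) y).
Proof.
apply: res_intro; rewrite mulC; apply: le_trans (le_mul_res x y).
by apply: mul_mono (le_refl _) (meet_l _ _).
Qed.
Lemma maltsev_l x z : maltsev x x z = z.
Proof.
have h : meet (res x x) e = e.
  by rewrite meetC; apply/res_ge_e; exact: le_refl.
rewrite /maltsev h res_e; exact: le_res_meet_res.
Qed.
Lemma maltsev_r x z : maltsev x z z = x.
Proof. by rewrite -{2}(maltsev_l z x) /maltsev meetC. Qed.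

End RL.

(** * Filters and quotients *)

Definition lattice_filter (A : algebra) (F : A -> Prop) : Prop :=
  [/\ F unit_e, forall x y, le x y -> F x -> F y
    & forall x y, F x -> F y -> F (meet x y)].

Definition filter_eq (A : algebra) (F : A -> Prop) (x y : A) : Prop :=
  F (res x y) /\ F (res y x).

Section FilterCongruence.
Variable A : algebra.
Hypothesis hA : is_RL A.
Hypothesis idA : idempotent_alg A.
Variable F : A -> Prop.
Hypothesis hF : lattice_filter F.
Implicit Types x y z : A.

Let F1 : F unit_e. Proof. by case: hF. Qed.
Let Fup x y : le x y -> F x -> F y. Proof. by case: hF => _ + _; apply. Qed.
Let Fmeet x y : F x -> F y -> F (meet x y). Proof. by case: hF => _ _; apply. Qed.

(** By idempotence [meet x y] is its own square, hence below [mul x y]. This makes lattice filters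
    containing [e] deductive. *)
Lemma filter_mul x y : F x -> F y -> F (mul x y).
Proof.
move=> hx hy.
apply: (@Fup (meet x y)); last exact: Fmeet.
rewrite -(idA (meet x y)); apply: (mul_mono hA); [exact: (meet_l hA) | exact: (meet_r hA)].
Qed.

Lemma filter_eq_refl x : filter_eq F x x.
Proof.
have h : F (res x x) by apply: Fup F1; apply/(res_ge_e hA)/(le_refl hA).
by split.
Qed.
Lemma filter_eq_sym x y : filter_eq F x y -> filter_eq F y x.
Proof. by case. Qed.
Lemma filter_eq_trans y x z : filter_eq F x y -> filter_eq F y z -> filter_eq F x z.
Proof.
move=> [h1 h2] [h3 h4]; split.
  by apply: Fup (filter_mul h1 h3); exact: (res_trans hA).
by apply: Fup (filter_mul h4 h2); exact: (res_trans hA).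
Qed.

Section Compat.
Variables x x' y y' : A.

Lemma filter_res_mul : F (res x x') -> F (res y y') ->
  F (res (mul x y) (mul x' y')).
Proof.
move=> h1 h2; apply: Fup (filter_mul h1 h2); apply: (res_intro hA).
have -> : mul (mul x y) (mul (res x x') (res y y')) =
          mul (mul x (res x x')) (mul y (res y y')).
  by rewrite -!(mulA hA); congr mul; rewrite !(mulA hA) (mulC hA y).
by apply: (mul_mono hA); exact: (le_mul_res hA).
Qed.

Lemma filter_res_res : F (res x' x) -> F (res y y') ->
  F (res (res x y) (res x' y')).
Proof.
move=> h1 h2; apply: Fup (filter_mul h1 h2); do 2!apply: (res_intro hA).
have -> : mul x' (mul (res x y) (mul (res x' x) (res y y'))) =
          mul (mul (mul x' (res x' x)) (res x y)) (res y y').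
  by rewrite !(mulA hA) -(mulA hA _ (res x y)) (mulC hA (res x y)) !(mulA hA).
apply: (le_trans hA) (le_mul_res hA y y').
apply: (mul_mono hA) (le_refl hA _).
apply: (le_trans hA) (le_mul_res hA x y).
by apply: (mul_mono hA) (le_refl hA _); exact: (le_mul_res hA).
Qed.

Lemma filter_res_meet : F (res x x') -> F (res y y') ->
  F (res (meet x y) (meet x' y')).
Proof.
move=> h1 h2; apply: Fup (Fmeet h1 h2); apply: (res_intro hA).
apply: (meet_glb hA); [apply: (le_trans hA) (le_mul_res hA x x')
                      | apply: (le_trans hA) (le_mul_res hA y y')];
  by apply: (mul_mono hA); first [exact: (meet_l hA) | exact: (meet_r hA)].
Qed.

Lemma filter_res_join : F (res x x') -> F (res y y') ->
  F (res (join x y) (join x' y')).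
Proof.
move=> h1 h2; apply: Fup (Fmeet h1 h2); apply: (res_intro hA).
rewrite (mulC hA); apply/(residuation hA).
apply: (join_lub hA); apply: (res_intro hA); rewrite (mulC hA).
  apply: (le_trans hA) (join_l hA x' y').
  apply: (le_trans hA) (le_mul_res hA x x').
  by apply: (mul_mono hA) (le_refl hA _) (meet_l hA _ _).
apply: (le_trans hA) (join_r hA x' y').
apply: (le_trans hA) (le_mul_res hA y y').
by apply: (mul_mono hA) (le_refl hA _) (meet_r hA _ _).
Qed.
End Compat.

Lemma filter_eq_mul x x' y y' : filter_eq F x x' -> filter_eq F y y' ->
  filter_eq F (mul x y) (mul x' y').
Proof. by move=> [? ?] [? ?]; split; exact: filter_res_mul. Qed.
Lemma filter_eq_res x x' y y' : filter_eq F x x' -> filter_eq F y y' ->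
  filter_eq F (res x y) (res x' y').
Proof. by move=> [? ?] [? ?]; split; exact: filter_res_res. Qed.
Lemma filter_eq_meet x x' y y' : filter_eq F x x' -> filter_eq F y y' ->
  filter_eq F (meet x y) (meet x' y').
Proof. by move=> [? ?] [? ?]; split; exact: filter_res_meet. Qed.
Lemma filter_eq_join x x' y y' : filter_eq F x x' -> filter_eq F y y' ->
  filter_eq F (join x y) (join x' y').
Proof. by move=> [? ?] [? ?]; split; exact: filter_res_join. Qed.

Lemma filter_eq_meet_res x y : filter_eq F (meet x y) x <-> F (res x y).
Proof.
split=> [[_ h]|h].
  by apply: Fup h; apply: (res_mono hA) (le_refl hA _) (meet_r hA _ _).
split; first by apply: Fup F1; apply/(res_ge_e hA)/(meet_l hA).
have [hx _] := filter_eq_refl x.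
apply: Fup (Fmeet hx h); apply: (res_intro hA); apply: (meet_glb hA).
  apply: (le_trans hA) (le_mul_res hA x x).
  by apply: (mul_mono hA) (le_refl hA _) (meet_l hA _ _).
apply: (le_trans hA) (le_mul_res hA x y).
by apply: (mul_mono hA) (le_refl hA _) (meet_r hA _ _).
Qed.

(** A class is encoded as the predicate [filter_eq F x], so that congruent elements have equal
    classes by extensionality; [rep] chooses a representative. *)
Let qcarrier := {X : A -> Prop | exists x, X = filter_eq F x}.
Let cls x : qcarrier := exist _ (filter_eq F x) (ex_intro _ x erefl).
Let rep (X : qcarrier) : A := projT1 (cid (proj2_sig X)).

Let clsP x y : cls x = cls y <-> filter_eq F x y.
Proof.
split=> [[h]|h].
  by rewrite h; exact: filter_eq_refl.
apply: eq_exist; apply: funext => z; apply: propext; split.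
  by apply: filter_eq_trans; exact: filter_eq_sym.
exact: filter_eq_trans.
Qed.

Let repK X : cls (rep X) = X.
Proof.
by case: X => X hX; apply: eq_exist; rewrite /rep /=; case: (cid _) => x /= <-.
Qed.

Lemma filter_quotient : exists (C : algebra) (f : A -> C),
  [/\ is_hom f, surjective f & forall x y, f x = f y <-> filter_eq F x y].
Proof.
pose C := @Algebra qcarrier
  (fun X Y => cls (mul (rep X) (rep Y))) (fun X Y => cls (res (rep X) (rep Y)))
  (fun X Y => cls (meet (rep X) (rep Y))) (fun X Y => cls (join (rep X) (rep Y)))
  (cls unit_e).
have repP x : filter_eq F x (rep (cls x)) by apply/clsP; rewrite repK.
exists C, (cls : A -> C); split; last exact: clsP; last by move=> X; exists (rep X).
split=> // x y; apply/clsP.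
- exact: filter_eq_mul.
- exact: filter_eq_res.
- exact: filter_eq_meet.
- exact: filter_eq_join.
Qed.

Lemma filter_quotient_le (C : algebra) (f : A -> C) x y : is_hom f ->
  (forall u v, f u = f v <-> filter_eq F u v) -> le (f x) (f y) <-> F (res x y).
Proof.
by move=> [_ _ f3 _ _] hf; rewrite /le -f3 hf filter_eq_meet_res.
Qed.

(* [s] picks a representative in [H] of every congruence class; [k] need only
   respect the congruence on [H]. *)
Lemma hom_of_section (C : algebra) (H : A -> Prop) (s : A -> A) (k : A -> C) :
  subuniverse H -> is_hom k ->
  (forall x, H (s x)) -> (forall x, filter_eq F (s x) x) ->
  (forall x y, H x -> H y -> filter_eq F x y -> k x = k y) ->
  is_hom (k \o s).
Proof.
move=> [H1 H2 H3 H4 H5] [k1 k2 k3 k4 k5] Hs sP hk; split=> [x y|x y|x y|x y|] /=.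
- rewrite -k1; apply: hk => //; first exact: H1.
  by apply: filter_eq_trans (sP _) (filter_eq_mul _ _); exact: filter_eq_sym.
- rewrite -k2; apply: hk => //; first exact: H2.
  by apply: filter_eq_trans (sP _) (filter_eq_res _ _); exact: filter_eq_sym.
- rewrite -k3; apply: hk => //; first exact: H3.
  by apply: filter_eq_trans (sP _) (filter_eq_meet _ _); exact: filter_eq_sym.
- rewrite -k4; apply: hk => //; first exact: H4.
  by apply: filter_eq_trans (sP _) (filter_eq_join _ _); exact: filter_eq_sym.
- by rewrite -k5; exact: hk.
Qed.

End FilterCongruence.

(** * Prime filters *)

Definition prime_filter (A : algebra) (F : A -> Prop) : Prop :=
  lattice_filter F /\ forall x y, F (join x y) -> F x \/ F y.

Section Semilinear.
Variable A : algebra.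
Hypothesis hA : is_RL A.
Hypothesis slA : semilinear A.
Implicit Types x y z : A.

Lemma semilinear_distr x y z : meet x (join y z) = join (meet x y) (meet x z).
Proof.
pose v n := match n with 0 => x | 1 => y | _ => z end.
apply: (@semilinear_satisfies A
  (Meet (Var 0) (Join (Var 1) (Var 2)))
  (Join (Meet (Var 0) (Var 1)) (Meet (Var 0) (Var 2))) slA _ v).
move=> C hC tC w /=; move: (w 0) (w 1) (w 2) => a b c.
have mono (u1 u2 : C) : le u1 u2 -> le (meet a u1) (meet a u2).
  move=> h; apply: (meet_glb hC) (meet_l hC _ _) _.
  exact: (le_trans hC) (meet_r hC _ _) h.
have [h|h] := tC b c.
  by move/(le_joinE hC): (h) => ->; move/(le_joinE hC): (mono _ _ h) => ->.
rewrite (joinC hC) (joinC hC (meet a b)).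
by move/(le_joinE hC): (h) => ->; move/(le_joinE hC): (mono _ _ h) => ->.
Qed.

Lemma semilinear_prelinear x y : le unit_e (join (res x y) (res y x)).
Proof.
pose v n := match n with 0 => x | _ => y end.
apply: (@semilinear_satisfies A
  (Meet Unit (Join (Res (Var 0) (Var 1)) (Res (Var 1) (Var 0)))) Unit slA _ v).
move=> C hC tC w /=; move: (w 0) (w 1) => a b.
have [h|h] := tC a b.
  by apply: (le_trans hC) (join_l hC _ _); apply/(res_ge_e hC).
by apply: (le_trans hC) (join_r hC _ _); apply/(res_ge_e hC).
Qed.

(** The prime filter theorem, for the filter above [e] and the directed set [J]: a maximal filter
    avoiding [J] is prime by distributivity. *)
Lemma prime_filter_avoiding (J : A -> Prop) :
  (forall x y, J x -> J y -> exists2 z, J z & le x z /\ le y z) ->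
  (forall x, J x -> ~ le unit_e x) ->
  exists2 F, prime_filter F & forall x, J x -> ~ F x.
Proof.
move=> Jdir Je.
(* The empty set is admitted so that the union of the empty chain is too. *)
pose P (X : set A) := [/\ forall x, X x -> X unit_e,
  forall x y, le x y -> X x -> X y, forall x y, X x -> X y -> X (meet x y)
  & forall x, J x -> ~ X x].
have [M [[M1 Mup Mmeet MJ] Mmax]] : exists M, P M /\ forall X, (M `<` X)%classic -> ~ P X.
  apply: Zorn_bigcup => G GP Gtot; split.
  - by move=> x [X GX /= Xx]; exists X => //=; case: (GP X GX) => + _ _ _; apply; exact: Xx.
  - move=> x y xy [X GX /= Xx]; exists X => //=.
    by case: (GP X GX) => _ + _ _; apply; [exact: xy | exact: Xx].
  - move=> x y [X GX /= Xx] [Y GY /= Yy]; have [XY|YX] := Gtot X Y GX GY.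
      by exists Y => //=; case: (GP Y GY) => _ _ + _; apply => //; exact: XY.
    by exists X => //=; case: (GP X GX) => _ _ + _; apply => //; exact: YX.
  - by move=> x Jx [X GX /= Xx]; case: (GP X GX) => _ _ _ /(_ x Jx); apply.
(* Otherwise [M] is empty, and the filter above [e] is larger. *)
have Me : M unit_e.
  apply: contrapT => nMe; apply: (Mmax (le unit_e)).
    split=> [x Mx|hs]; first by case: nMe; exact: M1 Mx.
    by apply: nMe; apply: hs; exact: (le_refl hA).
  split=> [x _|x y xy ex|x y|//]; first exact: (le_refl hA).
    exact: (le_trans hA) ex xy.
  exact: (meet_glb hA).
(* By maximality, the filter generated by [M] and an element outside [M] meets [J]. *)
have ext u : ~ M u -> exists2 w, M w & exists2 j, J j & le (meet w u) j.
  move=> nMu; apply: contrapT => hn.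
  apply: (Mmax (fun x => exists2 w, M w & le (meet w u) x)).
    split=> [x Mx|hs]; first by exists x => //; exact: (meet_l hA).
    by apply: nMu; apply: hs; exists unit_e => //; exact: (meet_r hA).
  split.
  - by move=> x _; exists unit_e => //; exact: (meet_l hA).
  - by move=> x y xy [w Mw wx]; exists w => //; exact: (le_trans hA) wx xy.
  - move=> x y [w Mw wx] [w' Mw' wy]; exists (meet w w'); first exact: Mmeet.
    have h1 := meet_l hA (meet w w') u; have h2 := meet_r hA (meet w w') u.
    apply: (meet_glb hA).
      apply: (le_trans hA) wx; apply: (meet_glb hA) => //.
      exact: (le_trans hA) h1 (meet_l hA _ _).
    apply: (le_trans hA) wy; apply: (meet_glb hA) => //.
    exact: (le_trans hA) h1 (meet_r hA _ _).
  - by move=> x Jx [w Mw wx]; apply: hn; exists w => //; exists x.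
exists M => //; split=> // u v Muv; apply: contrapT => hn.
have [|w Mw [j Jj wj]] := ext u; first by move=> h; apply: hn; left.
have [|w' Mw' [j' Jj' wj']] := ext v; first by move=> h; apply: hn; right.
have [z Jz [jz j'z]] := Jdir _ _ Jj Jj'.
apply: (MJ z Jz); apply: Mup (Mmeet _ _ (Mmeet _ _ Mw Mw') Muv).
have h1 t : le (meet (meet w w') t) w.
  exact: (le_trans hA) (meet_l hA _ _) (meet_l hA _ _).
have h2 t : le (meet (meet w w') t) w'.
  exact: (le_trans hA) (meet_l hA _ _) (meet_r hA _ _).
rewrite semilinear_distr; apply: (join_lub hA).
  by apply: (le_trans hA) jz; apply: (le_trans hA) wj; apply: (meet_glb hA) (h1 _) (meet_r hA _ _).
by apply: (le_trans hA) j'z; apply: (le_trans hA) wj'; apply: (meet_glb hA) (h2 _) (meet_r hA _ _).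
Qed.

(** Prelinearity puts the join of the two residuals in [F]; primality selects one of them, which
    orders the two classes. *)
Lemma prime_quotient_total (F : A -> Prop) (C : algebra) (f : A -> C) :
  prime_filter F -> is_hom f -> surjective f ->
  (forall x y, f x = f y <-> filter_eq F x y) -> totally_ordered C.
Proof.
move=> [hF pF] hf sf fP c d; have [x <-] := sf c; have [y <-] := sf d.
rewrite !(filter_quotient_le hA hF _ _ hf fP); apply: pF.
by case: hF => F1 Fup _; apply: Fup F1; exact: semilinear_prelinear.
Qed.

End Semilinear.

(** * Totally ordered idempotent residuated lattices *)

Section Chain.
Variable C : algebra.
Hypothesis hC : is_RL C.
Hypothesis idC : idempotent_alg C.
Hypothesis tC : totally_ordered C.
Implicit Types x y z : C.
Local Notation e := (@unit_e C).

Lemma chain_meet (H : C -> Prop) x y : H x -> H y -> H (meet x y).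
Proof. by have [->//|] := tC x y; rewrite (meetC hC) => ->. Qed.

Lemma chain_join (H : C -> Prop) x y : H x -> H y -> H (join x y).
Proof.
have [/(le_joinE hC) ->//|/(le_joinE hC)] := tC x y.
by rewrite (joinC hC) => ->.
Qed.

Lemma mul_le_l x y : le (mul x y) e -> le (mul x y) x.
Proof.
by move/(mul_mono hC (le_refl hC x)); rewrite (mulA hC) idC (mulr1 hC).
Qed.

Lemma mul_ge_l x y : le e (mul x y) -> le x (mul x y).
Proof.
by move/(mul_mono hC (le_refl hC x)); rewrite (mulA hC) idC (mulr1 hC).
Qed.

(** A product below [e] is the smaller factor, a product above [e] the larger. *)
Lemma chain_mul x y : mul x y = x \/ mul x y = y.
Proof.
wlog xy : x y / le x y.
  move=> h; have [|yx] := tC x y; first exact: h.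
  by rewrite (mulC hC); have [] := h _ _ yx; [right|left].
have [h|h] := tC (mul x y) e; [left|right]; apply: (le_anti hC).
- exact: mul_le_l.
- by have := mul_mono hC (le_refl hC x) xy; rewrite idC.
- by have := mul_mono hC xy (le_refl hC y); rewrite idC.
- by rewrite (mulC hC) in h *; exact: mul_ge_l.
Qed.

(** The product of [x] and [res x y] is one of its factors, and it cannot be [x]. Consequently a
    filter containing [res x y] contains [y] and [star x]. *)
Lemma chain_res_lt x y : ~ le x y -> le (res x y) y /\ le (res x y) (star x).
Proof.
move=> nxy; have h := le_mul_res hC x y; split.
  by have [E|E] := chain_mul x (res x y); rewrite E in h.
apply: (res_intro hC); have [//|/mul_ge_l h'] := tC (mul x (res x y)) e.
by case: nxy; exact: (le_trans hC) h' h.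
Qed.

(** The residual is the join of [star x] and [y] when [x <= y], and their meet otherwise. So in a
    chain closure under [star] gives closure under [res]. *)
Lemma chain_res x y : res x y = star x \/ res x y = y.
Proof.
have [xy|nxy] := pselect (le x y).
  have ys : le y (res x y).
    by apply: (res_intro hC); have := mul_mono hC xy (le_refl hC y); rewrite idC.
  have ss : le (star x) (res x y).
    apply: (res_intro hC); apply: (le_trans hC) xy.
    by apply: mul_le_l; exact: (le_mul_res hC).
  have [h|h] := tC (mul x (res x y)) e.
    by left; apply: (le_anti hC) => //; exact: (res_intro hC).
  right; apply: (le_anti hC) => //; apply: (le_trans hC) (le_mul_res hC x y).
  by rewrite (mulC hC) in h *; exact: mul_ge_l.
have [h1 h2] := chain_res_lt nxy.
have h u : le u y -> le u (star x) -> le u (res x y).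
  move=> uy /(residuation hC) us; apply: (res_intro hC); apply: (le_trans hC) uy.
  by rewrite (mulC hC) in us *; exact: mul_le_l.
by have [ys|sy] := tC y (star x); [right|left]; apply: (le_anti hC) => //;
  apply: h => //; exact: (le_refl hC).
Qed.

(** [D x] and [D (star x)] together say that [x] is congruent to [e] modulo [D]. All other classes
    are singletons, so [e] and the elements outside its class form a transversal; the condition on
    [star] makes it a subuniverse. *)
Lemma chain_collapse (D : C -> Prop) : lattice_filter D ->
  (forall x, D (star x) -> D (star (star x)) -> D x \/ star x = e) ->
  exists h : C -> C, [/\ is_hom h, forall x, D x -> D (star x) -> h x = e
    & forall x, x = e \/ ~ (D x /\ D (star x)) -> h x = x].
Proof.
move=> hD Dstar; case: (hD) => D1 Dup _.
pose S x := D x /\ D (star x).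
pose H x := x = e \/ ~ S x.
pose s x := if pselect (S x) then e else x.
have Hstar x : H x -> H (star x).
  move=> [->|nS]; first by left; exact: (star_e hC).
  have [[h1 h2]|] := pselect (S (star x)); last by right.
  by have [Dx| ->] := Dstar x h1 h2; [case: nS | left].
have Huniv : subuniverse H.
  split; last by left.
  - by move=> x y Hx Hy; have [->| ->] := chain_mul x y.
  - by move=> x y Hx Hy; have [->| ->] := chain_res x y => //; exact: Hstar.
  - exact: chain_meet.
  - exact: chain_join.
have Hinj x y : H x -> H y -> filter_eq D x y -> x = y.
  have lt_S u v : ~ le u v -> D (res u v) -> S u /\ S v.
    move=> nuv Duv; have [h1 h2] := chain_res_lt nuv.
    have vu : le v u by have [|] := tC u v.
    have Dv := Dup _ _ h1 Duv; have Dsu := Dup _ _ h2 Duv.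
    split; split => //; first exact: Dup vu Dv.
    exact: Dup (star_anti hC vu) Dsu.
  move=> Hx Hy [Dxy Dyx].
  have [xy|/lt_S /(_ Dxy) [Sx Sy]] := pselect (le x y); last first.
    by have -> : x = e; [case: Hx | case: Hy].
  have [yx|/lt_S /(_ Dyx) [Sy Sx]] := pselect (le y x); first exact: (le_anti hC).
  by have -> : x = e; [case: Hx | case: Hy].
have Hs x : H (s x) by rewrite /s; case: pselect => h; [left | right].
have sP x : filter_eq D (s x) x.
  rewrite /s; case: pselect => [[h1 h2]|?] /=; last exact: filter_eq_refl.
  by split=> //; rewrite (res_e hC).
exists s; split.
- exact: (hom_of_section hC idC hD Huniv (@hom_id C) Hs sP Hinj).
- by move=> x h1 h2; rewrite /s; case: pselect => // -[].
- by move=> x [->|h]; rewrite /s; case: pselect.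
Qed.

Hypothesis ssC : forall x, star (star (join x e)) = join x e.

Lemma starstar_pos x : le e x -> star (star x) = x.
Proof.
move=> /(le_joinE hC) h; have := ssC x.
by rewrite (joinC hC) h.
Qed.

Lemma chain_separate (H : C -> Prop) b : subuniverse H ->
  le b e -> ~ H b -> (forall a, H a -> le b a -> le a e -> a = e) ->
  exists h : C -> C, [/\ is_hom h, forall a, H a -> h a = a & h b <> b].
Proof.
move=> [_ Hres _ _ He] be nHb gap.
have Hstar a : H a -> H (star a) by move=> Ha; exact: Hres.
have nbe : b <> e by move=> h; apply: nHb; rewrite h.
have ebs := star_neg hC be.
have [bse|nbse] := pselect (star b = e).
  have bstar x : le b (star x) <-> le x e by rewrite (le_star hC) bse.
  (* The class of [e] is now the interval from [b] to [e], which by [gap] contains no element of [H]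
     except [e]. *)
  have [||h [hh hS hH]] := @chain_collapse (le b).
  - split=> //; first by move=> x y xy bx; exact: (le_trans hC) bx xy.
    by move=> x y; exact: (meet_glb hC).
  - move=> x _ /bstar sxe; have [xe|ex] := tC x e.
      by right; apply: (le_anti hC) => //; exact: (star_neg hC).
    by left; exact: (le_trans hC) be ex.
  exists h; split=> // [a Ha|].
    apply: hH; have [[ba /bstar ae]|] := pselect (le b a /\ le b (star a)).
      by left; exact: gap.
    by right.
  by rewrite hS ?bse //; [exact: nesym | exact: (le_refl hC)].
(* For the filter above [b], an element strictly below [b] with the same star would violate the
   condition on [star]. A filter defined through [star] satisfies it by [star3]. *)
have [||h [hh hS hH]] := @chain_collapse (fun x => le (star x) (star b)).
- split; first by rewrite (star_e hC).
    by move=> x y xy; apply: (le_trans hC); exact: (star_anti hC).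
  by move=> x y; exact: (@chain_meet (fun x => le (star x) (star b))).
- by move=> x _; rewrite (star3 hC); left.
have bss : le (star (star b)) e by exact: (star_pos hC).
exists h; split=> // [a Ha|].
  apply: hH; have [[h1 h2]|] := pselect (le (star a) (star b) /\ le (star (star a)) (star b));
    last by right.
  left; have [ae|ea] := tC a e.
    have [ba|ab] := tC b a; first exact: gap.
    (* An [a] below [b] shares the star of [b], so [star (star b)] is in [H]; then [gap] makes it
       [e], which forces [star b = e]. *)
    case: nbse; have E : star a = star b by apply: (le_anti hC) h1 (star_anti hC ab).
    have E2 : star (star b) = e.
      by apply: gap bss; [rewrite -E; exact: Hstar (Hstar _ Ha) | exact: (le_starstar hC)].
    by rewrite -(star3 hC) E2 (star_e hC).
  rewrite (starstar_pos ea) in h2.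
  have E : star a = e.
    apply: gap; [exact: Hstar | | exact: (star_pos hC)].
    by apply/(le_star hC).
  by rewrite -(starstar_pos ea) E (star_e hC).
rewrite hS; [exact: nesym | exact: (le_refl hC) | exact: (le_trans hC) bss ebs].
Qed.

End Chain.

(** * Epimorphisms *)

Section Epic.
Variable K : algebra -> Prop.
Hypothesis hvar : is_variety K.
Hypothesis hGSM : forall A, K A -> generalized_Sugihara_monoid A.

(** For a subuniverse [H], its inclusion is an epimorphism; no algebra on [H] has to be formed. *)
Definition epic_in (B : algebra) (H : B -> Prop) : Prop :=
  forall (C : algebra) (g h : B -> C), K C -> is_hom g -> is_hom h ->
    (forall a, H a -> g a = h a) -> g =1 h.

Lemma epic_in_quotient (B C : algebra) (f : B -> C) (H : B -> Prop) :
  is_hom f -> surjective f -> epic_in H ->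
  epic_in (fun c => exists2 x, H x & f x = c).
Proof.
move=> hf sf Hepi D g h KD hg hh gh c; have [x <-] := sf c.
apply: (Hepi D (g \o f) (h \o f)) => //; try exact: hom_comp.
by move=> a Ha /=; apply: gh; exists a.
Qed.

Lemma epic_in_chain (C : algebra) (H : C -> Prop) :
  K C -> totally_ordered C -> subuniverse H -> epic_in H -> forall b, H b.
Proof.
move=> KC tC HU Hepi b; have [hC _ idC ssC] := hGSM KC.
apply: contrapT => nHb.
(* If [b] is above [e], then [b] is the star of [star b], so [H] misses [star b] as well. *)
wlog be : b nHb / le b unit_e.
  move=> hw; have [|eb] := tC b unit_e; first exact: hw.
  apply: (hw (star b)); last exact: (star_pos hC).
  case: HU => _ Hres _ _ He h; apply: nHb.
  by rewrite -(starstar_pos hC ssC eb); exact: Hres.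
(* The filter generated by the elements of [H] strictly above [b]; it contains nothing below [b]. *)
pose F x := exists2 a, H a & ~ le a b /\ le a x.
have He : H unit_e by case: HU.
have neb : ~ le unit_e b by move=> eb; apply: nHb; rewrite (le_anti hC be eb).
have hF : lattice_filter F.
  split; first by exists unit_e => //; split=> //; exact: (le_refl hC).
    by move=> x y xy [a Ha [nab ax]]; exists a => //; split=> //; exact: (le_trans hC) ax xy.
  by move=> x y; exact: (chain_meet hC tC).
have nFb x : le x b -> ~ F x.
  by move=> xb [a Ha [nab ax]]; apply: nab; exact: (le_trans hC) ax xb.
have [Q [f [hf sf fP]]] := filter_quotient hC idC hF.
have fle x y := filter_quotient_le hC hF x y hf fP.
have f1 : f unit_e = unit_e by case: hf.
have KQ := variety_quotient hvar KC hf sf.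
have [hQ _ idQ ssQ] := hGSM KQ.
have fmono x y : le x y -> le (f x) (f y).
  by move=> xy; apply/fle; case: hF => F1 Fup _; apply: Fup F1; apply/(res_ge_e hC).
have tQ : totally_ordered Q.
  move=> c d; have [x <-] := sf c; have [y <-] := sf d.
  by have [/fmono|/fmono] := tC x y; [left|right].
pose H' c := exists2 x, H x & f x = c.
(* If [f a = f b] with [a <> b], the residual from the larger to the smaller is at most the smaller,
   hence at most [b] and outside [F]. *)
have nH' : ~ H' (f b).
  move=> [a Ha /fP [Fab Fba]].
  have [ab|nab] := pselect (le a b); last first.
    by have [h _] := chain_res_lt hC idC tC nab; exact: nFb h Fab.
  have [ba|nba] := pselect (le b a).
    by apply: nHb; rewrite (le_anti hC ba ab).
  have [h _] := chain_res_lt hC idC tC nba.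
  exact: (nFb _ (le_trans hC h ab) Fba).
have be' : le (f b) unit_e by rewrite -f1; exact: fmono.
have [|h [hh hfix hb]] := chain_separate hQ idQ tQ ssQ (subuniverse_image hf HU) be' nH'.
  (* An [a] at most [b] would be identified with [b]; any other [a] lies in [F] and maps above
     [e]. *)
  move=> _ [a Ha <-] fba fae; have [ab|nab] := pselect (le a b).
    by case: nH'; exists a => //; apply: (le_anti hQ) fba; exact: fmono.
  apply: (le_anti hQ) fae _; rewrite -f1; apply/fle; rewrite (res_e hC).
  by exists a => //; split=> //; exact: (le_refl hC).
apply: hb; apply: (epic_in_quotient hf sf Hepi KQ hh (@hom_id Q)) => a Ha.
exact: hfix.
Qed.

(** * From prime quotients to the whole algebra *)

Section Extension.
Variables (B : algebra) (H : B -> Prop).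
Hypothesis KB : K B.
Hypothesis HU : subuniverse H.
Hypothesis Hepi : epic_in H.

Lemma epic_prime_onto (p : B -> Prop) (x : B) : prime_filter p ->
  exists2 a, H a & filter_eq p a x.
Proof.
have [hB slB idB _] := hGSM KB => hp; have [hF _] := hp.
have [P [f [hf sf fP]]] := filter_quotient hB idB hF.
have tP := prime_quotient_total hB slB hp hf sf fP.
have KP := variety_quotient hvar KB hf sf.
have [a Ha /fP] := epic_in_chain KP tP (subuniverse_image hf HU)
  (epic_in_quotient hf sf Hepi) (f x).
by exists a.
Qed.

Lemma epic_two_primes (p q : B -> Prop) (b : B) : prime_filter p -> prime_filter q ->
  exists2 m, H m & filter_eq p m b /\ filter_eq q m b.
Proof.
have [hB slB idB _] := hGSM KB => hp hq; have [pF _] := hp; have [qF _] := hq.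
have [p1 pup pmeet] := pF; have [q1 qup qmeet] := qF.
have [Hmul Hres Hmeet Hjoin He] := HU.
pose r x := exists2 c, p c & exists2 d, H d /\ q d & le (meet c d) x.
have rF : lattice_filter r.
  split.
  - by exists unit_e => //; exists unit_e => //; exact: (meet_l hB).
  - move=> x y xy [c pc [d hd cd]]; exists c => //; exists d => //.
    exact: (le_trans hB) cd xy.
  - move=> x y [c pc [d [Hd qd] cdx]] [c' pc' [d' [Hd' qd'] cdy]].
    exists (meet c c'); first exact: pmeet.
    exists (meet d d'); first by split; [exact: Hmeet | exact: qmeet].
    have h1 := meet_l hB (meet c c') (meet d d').
    have h2 := meet_r hB (meet c c') (meet d d').
    apply: (meet_glb hB).
      apply: (le_trans hB) cdx; apply: (meet_glb hB).
        exact: (le_trans hB) h1 (meet_l hB _ _).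
      exact: (le_trans hB) h2 (meet_l hB _ _).
    apply: (le_trans hB) cdy; apply: (meet_glb hB).
      exact: (le_trans hB) h1 (meet_r hB _ _).
    exact: (le_trans hB) h2 (meet_r hB _ _).
have pr x : p x -> r x.
  by move=> px; exists x => //; exists unit_e => //; exact: (meet_l hB).
have qr x : H x -> q x -> r x.
  by move=> Hx qx; exists unit_e => //; exists x => //; exact: (meet_r hB).
have /choice [s sP] : forall x, exists a, H a /\ filter_eq q a x.
  by move=> x; have [a Ha hax] := epic_prime_onto x hq; exists a.
have [E [f [hf sf fP]]] := filter_quotient hB idB rF.
have KE := variety_quotient hvar KB hf sf.
(* Makes the second map well defined: both residuals lie in [H] and in [q], hence in [r]. *)
have fH x y : H x -> H y -> filter_eq q x y -> f x = f y.
  by move=> Hx Hy [h1 h2]; apply/fP; split; apply: qr => //; exact: Hres.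
have hfs : is_hom (f \o s).
  by apply: (hom_of_section hB idB qF HU hf _ _ fH) => x; case: (sP x).
have /fP bs : f b = f (s b).
  apply: (Hepi KE hf hfs) => a Ha /=; have [Hs qs] := sP a.
  by apply: fH => //; exact: filter_eq_sym.
have [a1 Ha1 pa1] := epic_prime_onto b hp; have [Ha2 qa2] := sP b.
move: (s b) Ha2 qa2 bs => a2 Ha2 qa2 bs.
have a12 : filter_eq r a1 a2.
  by apply: (filter_eq_trans hB idB rF) bs; case: pa1 => ? ?; split; exact: pr.
have [_ _ rmeet] := rF.
case: a12 => /rmeet h /h {h} [c pc [d0 [Hd0 qd0] cd0w]].
(* Cut at [e], [d] becomes [e] modulo [q]; modulo [p], where [c] is above [e], it lies below both
   residuals. *)
have [d [Hd qd de cdw]] : exists d, [/\ H d, q d, le d unit_e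
    & le (meet c d) (meet (res a1 a2) (res a2 a1))].
  exists (meet d0 unit_e); split; [exact: Hmeet | exact: qmeet | exact: (meet_r hB) |].
  by apply: (le_trans hB) cd0w; rewrite (meetA hB); exact: (meet_l hB).
(* Modulo [p] the last two arguments coincide, leaving [a1]; modulo [q], where [d] is [e], the first
   two coincide, leaving [a2]. *)
exists (maltsev a1 (mul d a1) (mul d a2)).
  by rewrite /maltsev; do ![apply: (Hmeet) | apply: (Hres) | apply: (Hmul)].
have filter_ge_e (F : B -> Prop) (Q : algebra) (k : B -> Q) x : lattice_filter F ->
    is_hom k -> (forall x y, k x = k y <-> filter_eq F x y) -> F x -> le unit_e (k x).
  move=> hF hk kP Fx; case: (hk) => _ _ _ _ <-.
  by apply/(filter_quotient_le hB hF _ _ hk kP); rewrite (res_e hB).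
have hom_maltsev (Q : algebra) (k : B -> Q) x y z : is_hom k ->
    k (maltsev x y z) = maltsev (k x) (k y) (k z).
  by case=> k1 k2 k3 k4 k5; rewrite /maltsev !(k2, k3) !k5.
have hom_le (Q : algebra) (k : B -> Q) x y : is_hom k -> le x y -> le (k x) (k y).
  by move=> [_ _ k3 _ _] xy; rewrite /le -k3 xy.
split.
  have [P [k [hk sk kP]]] := filter_quotient hB idB pF.
  have [hP _ idP _] := hGSM (variety_quotient hvar KB hk sk).
  apply: (filter_eq_trans hB idB pF) pa1; apply/kP; rewrite (hom_maltsev _ _ _ _ _ hk).
  have ec : le unit_e (k c) by exact: filter_ge_e pc.
  have [k1 k2 k3 _ k5] := hk.
  have kdw : le (k d) (k (meet (res a1 a2) (res a2 a1))).
    apply: (le_trans hP) (hom_le _ _ _ _ hk cdw); rewrite k3.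
    apply: (meet_glb hP) (le_refl hP _); apply: (le_trans hP) ec.
    by rewrite -k5; exact: hom_le.
  (* Multiply [mul (k d) x <= y] by [k d] once more and use idempotence. *)
  have mono x y : le (k d) (res x y) -> le (mul (k d) x) (mul (k d) y).
    move/(residuation hP)/(mul_mono hP (le_refl hP (k d))).
    by rewrite (mulC hP x) (mulA hP) idP.
  rewrite !k1; have -> : mul (k d) (k a1) = mul (k d) (k a2).
    rewrite k3 !k2 in kdw.
    apply: (le_anti hP); apply: mono; apply: (le_trans hP) kdw _;
      [exact: (meet_l hP) | exact: (meet_r hP)].
  exact: (maltsev_r hP).
have [P [k [hk sk kP]]] := filter_quotient hB idB qF.
have [hP _ _ _] := hGSM (variety_quotient hvar KB hk sk).
apply: (filter_eq_trans hB idB qF) qa2; apply/kP; rewrite (hom_maltsev _ _ _ _ _ hk).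
have [k1 _ _ _ k5] := hk.
have kd : k d = unit_e.
  by apply: (le_anti hP); [rewrite -k5; exact: hom_le | exact: filter_ge_e qd].
by rewrite !k1 kd !(mul1 hP) (maltsev_l hP).
Qed.

Lemma epic_full (b : B) : H b.
Proof.
have [hB slB idB _] := hGSM KB.
have [_ _ Hmeet Hjoin _] := HU.
(* If no [a] in [H] congruent to [b] modulo [p] is below [b], some prime [q] avoids every such
   [res a b], against [epic_two_primes]. Meets of such [a] give directedness. *)
have below (p : B -> Prop) : prime_filter p ->
    exists2 a, H a & filter_eq p a b /\ le a b.
  move=> hp; have [pF _] := hp; apply: contrapT => hn.
  pose J x := exists2 a, H a & filter_eq p a b /\ x = res a b.
  have [||q hq qJ] := @prime_filter_avoiding B hB slB J.
  - move=> _ _ [a Ha [pa ->]] [a' Ha' [pa' ->]]; exists (res (meet a a') b).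
      exists (meet a a'); first exact: Hmeet.
      split=> //; have := filter_eq_meet hB pF pa pa'.
      by rewrite (le_refl hB).
    by split; apply: (res_mono hB) (le_refl hB _);
      [exact: (meet_l hB) | exact: (meet_r hB)].
  - by move=> _ [a Ha [pa ->]] /(res_ge_e hB) ab; apply: hn; exists a.
  have [m Hm [pm [qm _]]] := epic_two_primes b hp hq.
  by apply: qJ qm; exists m.
(* The dual gluing: joins of elements of [H] below [b]. A prime [q] avoiding every [res b a]
   contradicts [below], so some such [a] equals [b]. *)
pose J x := exists2 a, H a & le a b /\ x = res b a.
apply: contrapT => nHb.
have [||q hq qJ] := @prime_filter_avoiding B hB slB J.
- move=> _ _ [a Ha [ab ->]] [a' Ha' [ab' ->]]; exists (res b (join a a')).
    exists (join a a'); first exact: Hjoin.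
    by split=> //; exact: (join_lub hB).
  by split; apply: (res_mono hB (le_refl hB _));
    [exact: (join_l hB) | exact: (join_r hB)].
- move=> _ [a Ha [ab ->]] /(res_ge_e hB) ba.
  by apply: nHb; rewrite (le_anti hB ba ab).
have [a Ha [[_ qba] ab]] := below q hq.
by apply: qJ qba; exists a.
Qed.

End Extension.
End Epic.

Theorem theorem6p11 (K : algebra -> Prop)
    (hvar : is_variety K)
    (hGSM : forall A : algebra, K A -> generalized_Sugihara_monoid A) :
  ES_property K.
Proof.
move=> A B f [KA KB hf fepi].
have univ : subuniverse (fun _ : A => True) by [].
have hH := subuniverse_image hf univ.
suff hepi : epic_in K (fun y => exists2 x, True & f x = y).
  by move=> y; have [x _ <-] := epic_full hvar hGSM KB hH hepi y; exists x.
move=> C g h KC hg hh gh; apply: fepi => // x /=.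
by apply: gh; exists x.
Qed.
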